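(* Let $G=(V,E)$ be a finite undirected graph with $N=|V|$ nodes whose node set is partitioned into a set $\mathcal{C}$ of (nonempty) categories, let $A\in\mathcal{C}$, let $\mathrm{w}:V\to(0,\infty)$ be known sampling weights, and let $S$ be a weighted independence sample of size $n$ from $V$ with weights $\mathrm{w}$. Then the weighted induced-subgraph estimator of category size $$|\widehat{A}| = N\cdot\frac{\mathrm{w}_{-1}(S_A)}{\mathrm{w}_{-1}(S)},\qquad \mathrm{w}_{-1}(X)=\sum_{v\in X}\frac{1}{\mathrm{w}(v)},$$ is consistent for $|A|$, i.e. $|\widehat{A}|\to|A|$ in probability as $n\to\infty$.
   Context: Weighted independence sampling (WIS): $X_1,X_2,\dots$ are i.i.d. random nodes (sampling with replacement) with $P(X_i=v)=\pi(v)=\mathrm{w}(v)/\sum_{u\in V}\mathrm{w}(u)$, and $S$ is the multiset $\{X_1,\dots,X_n\}$; all sums over sub-multisets of $S$ count multiplicity. $S_A=\{v\in S: v\in A\}$ is the sub-multiset of samples in $A$. $G$, $N$ and $\mathrm{w}$ are fixed. *)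

(* Defs.v *)
From mathcomp Require Export all_boot all_order all_algebra finmap.
From mathcomp Require Export all_classical all_reals all_analysis.

Set Implicit Arguments.
Unset Strict Implicit.
Unset Printing Implicit Defensive.

Import Order.TTheory GRing.Theory Num.Theory.
Import numFieldNormedType.Exports.

Local Open Scope classical_set_scope.
Local Open Scope ring_scope.

Definition inv_weight (R : realType) (V : finType) (w : V -> R) (s : seq V) : R :=
  \sum_(v <- s) (w v)^-1.

Definition restrict_sample (V : finType) (A : {set V}) (s : seq V) : seq V :=
  [seq v <- s | v \in A].

Definition category_size_est (R : realType) (V : finType) (w : V -> R)
    (A : {set V}) (s : seq V) : R :=
  #|V|%:R * (inv_weight w (restrict_sample A s) / inv_weight w s).

Definition sampling_prob (R : realType) (V : finType) (w : V -> R) (v : V) : R :=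
  w v / \sum_(u : V) w u.

Section RandomNodes.
Context {d : measure_display} {T : measurableType d} {R : realType}.
Variable P : probability T R.

Definition mutually_independent (V : Type) (X : nat -> T -> V) : Prop :=
  forall (J : {fset nat}) (B : nat -> set V),
    P (\bigcap_(i in [set` J]) (X i @^-1` B i)) =
    (\prod_(i <- J) P (X i @^-1` B i))%E.

(* [V] carries the discrete sigma-algebra, so measurability of [X i] is asked
   of the preimage of every subset of [V]. *)
Definition weighted_independence_sampling (V : finType) (w : V -> R)
    (X : nat -> T -> V) : Prop :=
  [/\ forall (i : nat) (B : set V), measurable (X i @^-1` B),
      forall (i : nat) (v : V),
        P [set t | X i t = v] = (sampling_prob w v)%:E
    & mutually_independent X].

Definition cvg_in_probability (Y : nat -> T -> R) (l : R) : Prop :=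
  forall eps : R, 0 < eps ->
    P [set t | eps < `|Y n t - l|] @[n --> \oo] --> 0%E.

End RandomNodes.

(* The multiset of the first [n] draws, as the list [X 0 t; ...; X (n-1) t]. *)
Definition sample (T V : Type) (X : nat -> T -> V) (n : nat) (t : T) : seq V :=
  [seq X i t | i <- iota 0 n].

(* Main.v *)
From mathcomp Require Import ring.
Require Import Defs.

Set Implicit Arguments.
Unset Strict Implicit.
Unset Printing Implicit Defensive.

Import Order.TTheory GRing.Theory Num.Theory.
Import numFieldNormedType.Exports.

Local Open Scope ring_scope.

(* With f v = (N 1_A(v) - |A|) / w v, the estimation error is
   (sum_i f (X i)) / (sum_i 1 / w (X i)).  Under the sampling law the f (X i)
   are independent and centered, so the numerator has second moment O(n), while
   the denominator is at least n / W, W being the total weight.  Chebyshev's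
   inequality then bounds the probability of an error above eps by O(1 / n). *)

(** * Moments and Chebyshev's inequality for a product law on a finite power *)

Section ProductLaw.
Context {R : realFieldType} {V : finType}.
Variables (p f : V -> R).
Hypothesis p_sum1 : \sum_v p v = 1.

(** Each summand is a product over coordinates, so the sum over all [g] factors into one sum per
    coordinate. If [i] and [j] differ, the factor at [i] is the mean of [f], which is zero; if they
    agree, every other factor is the total mass 1. *)
Lemma product_law_cross_moment n (i j : 'I_n) :
  \sum_v p v * f v = 0 ->
  \sum_(g : {ffun 'I_n -> V}) (\prod_k p (g k)) * (f (g i) * f (g j)) =
  if i == j then \sum_v p v * f v ^+ 2 else 0.
Proof.
move=> f_mean0.
(* The two conditionals attach [f] to coordinates [i] and [j] separately, so that [f] occurs squared
   when [i = j]. *)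
pose h k v := p v * ((if k == i then f v else 1) * (if k == j then f v else 1)).
transitivity (\sum_(g : {ffun 'I_n -> V}) \prod_k h k (g k)).
  apply: eq_bigr => g _; rewrite /h !big_split /=; congr (_ * (_ * _)).
    by rewrite -big_mkcond big_pred1_eq.
  by rewrite -big_mkcond big_pred1_eq.
rewrite -bigA_distr_bigA (bigD1 i) //= /h eqxx.
have [<-|ij] := eqVneq i j; last first.
  by under eq_bigr do rewrite mulr1; rewrite f_mean0 mul0r.
rewrite [X in _ * X]big1 ?mulr1; last first.
  by move=> k /negbTE ->; under eq_bigr do rewrite !mulr1.
by apply: eq_bigr => v _; rewrite expr2.
Qed.

Lemma product_law_second_moment n :
  \sum_v p v * f v = 0 ->
  \sum_(g : {ffun 'I_n -> V}) (\prod_k p (g k)) * (\sum_k f (g k)) ^+ 2 =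
  n%:R * \sum_v p v * f v ^+ 2.
Proof.
move=> f_mean0.
under eq_bigr do rewrite expr2 big_distrlr /= mulr_sumr.
rewrite exchange_big /=.
under eq_bigr do (under eq_bigr do rewrite mulr_sumr; rewrite exchange_big /=).
under eq_bigr => i _.
  under eq_bigr do rewrite product_law_cross_moment // eq_sym.
  rewrite -big_mkcond big_pred1_eq; over.
by rewrite sumr_const card_ord mulr_natl.
Qed.

(** Each [g] in the event contributes at least [a ^+ 2] times its mass to the second moment, and
    every other [g] contributes a nonnegative term. *)
Lemma product_law_chebyshev n (a : R) :
  (forall v, 0 <= p v) -> \sum_v p v * f v = 0 -> 0 < a ->
  \sum_(g : {ffun 'I_n -> V} | a < `|\sum_k f (g k)|) \prod_k p (g k) <=
  n%:R * (\sum_v p v * f v ^+ 2) / a ^+ 2.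
Proof.
move=> p_ge0 f_mean0 a_gt0.
rewrite -product_law_second_moment // ler_pdivlMr ?exprn_gt0 // mulr_suml.
rewrite big_mkcond; apply: ler_sum => g _.
have prod_ge0 : 0 <= \prod_k p (g k) by apply: prodr_ge0.
case: ifP => [a_lt|_]; last by rewrite mulr_ge0 ?sqr_ge0.
rewrite ler_wpM2l // -[leRHS]real_normK ?num_real //.
by rewrite ler_sqr ?nnegrE ?(ltW a_gt0) // ltW.
Qed.

End ProductLaw.

(** * Deterministic analysis of the estimation error *)

Section Estimator.
Context {R : realType} {V : finType}.
Variables (w : V -> R) (A : {set V}).
Hypothesis w_gt0 : forall v, 0 < w v.

(** Dividing by [w v] cancels the sampling bias: under [sampling_prob] the mean is proportional to
    the unweighted sum of the numerators, N|A| - |A|N = 0. *)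
Definition centered_score (v : V) : R :=
  (#|V|%:R * (v \in A)%:R - #|A|%:R) / w v.

Lemma total_weight_gt0 (v : V) : 0 < \sum_u w u.
Proof.
by rewrite (bigD1 v) //= ltr_wpDr // sumr_ge0 // => u _; exact: ltW.
Qed.

Lemma centered_score_mean0 :
  \sum_v sampling_prob w v * centered_score v = 0.
Proof.
transitivity ((\sum_u w u)^-1 * \sum_v (#|V|%:R * (v \in A)%:R - #|A|%:R)).
  rewrite mulr_sumr; apply: eq_bigr => v _.
  rewrite /sampling_prob /centered_score [w v / _]mulrC -mulrA.
  by rewrite [w v * _]mulrCA mulfV ?gt_eqF // mulr1.
rewrite sumrB -mulr_sumr -natr_sum -big_mkcond sum1_card sumr_const.
rewrite -[X in _ - X]mulr_natl.
by rewrite subrr mulr0.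
Qed.

Lemma sampling_prob_ge0 (v : V) : 0 <= sampling_prob w v.
Proof. by rewrite divr_ge0 // ltW // (total_weight_gt0 v). Qed.

Lemma sampling_prob_sum1 (v0 : V) : \sum_v sampling_prob w v = 1.
Proof. by rewrite -mulr_suml mulfV // gt_eqF // (total_weight_gt0 v0). Qed.

(** No single weight exceeds the total weight, so each reciprocal is at least the reciprocal of the
    total. This replaces the random denominator of the estimator by a deterministic one. *)
Lemma inv_weight_ge (s : seq V) :
  (size s)%:R / \sum_u w u <= inv_weight w s.
Proof.
rewrite /inv_weight; elim: s => [|v s IHs]; first by rewrite big_nil mul0r.
rewrite big_cons /= -nat1r mulrDl mul1r lerD // lef_pV2 ?posrE //.
  by rewrite (bigD1 v) //= lerDl sumr_ge0 // => u _; exact: ltW.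
exact: total_weight_gt0.
Qed.

Lemma inv_weight_gt0 (s : seq V) : (0 < size s)%N -> 0 < inv_weight w s.
Proof.
case: s => [//|v s _]; apply: lt_le_trans (inv_weight_ge (v :: s)).
by rewrite divr_gt0 // (total_weight_gt0 v).
Qed.

Lemma category_size_est_error (s : seq V) : (0 < size s)%N ->
  category_size_est w A s - #|A|%:R =
  (\sum_(v <- s) centered_score v) / inv_weight w s.
Proof.
move=> s_gt0; have D0 : inv_weight w s != 0 by rewrite gt_eqF ?inv_weight_gt0.
(* Put [#|A|%:R] over the common denominator [inv_weight w s]; the numerators then agree term by
   term. *)
rewrite /category_size_est mulrA -[X in _ - X](mulfK D0) -mulrBl.
congr (_ / _); rewrite /inv_weight /restrict_sample big_filter !mulr_sumr.
rewrite [X in X - _]big_mkcond -sumrB; apply: eq_bigr => v _.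
by rewrite /centered_score mulrBl; case: (v \in A); rewrite ?mulr1 ?mulr0 ?mul0r.
Qed.

Lemma large_error_large_score (s : seq V) (eps : R) : (0 < size s)%N ->
  eps < `|category_size_est w A s - #|A|%:R| -> 0 < eps ->
  eps * ((size s)%:R / \sum_u w u) < `|\sum_(v <- s) centered_score v|.
Proof.
move=> s_gt0; have D_gt0 := inv_weight_gt0 s_gt0.
rewrite category_size_est_error // normrM normfV (gtr0_norm D_gt0).
rewrite ltr_pdivlMr // => err eps_gt0; apply: le_lt_trans err.
by rewrite ler_pM2l // inv_weight_ge.
Qed.

End Estimator.

(** * Joint law of the first [n] draws, and the tail bound *)

Section Sampling.
Context {d : measure_display} {T : measurableType d} {R : realType}.
Context {V : finType} {P : probability T R} {w : V -> R} {X : nat -> T -> V}.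
Hypothesis X_WIS : weighted_independence_sampling P w X.

(** This is the form that [mutually_independent] accepts, with sets indexed by all of [nat].
    Quantifying over [lt_in] gives the singleton of [g] at [i] when [i < n], and all of [V]
    otherwise. *)
Lemma sample_cylinder n (g : {ffun 'I_n -> V}) :
  [set t | [ffun k : 'I_n => X k t] = g]%classic =
  (\bigcap_(i in [set` [fset i in iota 0 n]%fset])
     (X i @^-1` [set v | forall lt_in : (i < n)%N, v = g (Ordinal lt_in)]))%classic.
Proof.
apply/seteqP; split=> t /=.
  by move=> <- i _ lt_in /=; rewrite ffunE.
move=> Xg; apply/ffunP => k; rewrite ffunE.
have := Xg k _ (ltn_ord k); rewrite /= => ->; first by congr (g _); exact: val_inj.
by rewrite !inE mem_iota /=.
Qed.

Lemma measurable_sample_cylinder n (g : {ffun 'I_n -> V}) :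
  measurable [set t | [ffun k : 'I_n => X k t] = g]%classic.
Proof.
have [X_meas _ _] := X_WIS.
by rewrite sample_cylinder; apply: bigcap_measurableType => i _; exact: X_meas.
Qed.

Lemma sample_law n (g : {ffun 'I_n -> V}) :
  P [set t | [ffun k : 'I_n => X k t] = g]%classic =
  (\prod_k sampling_prob w (g k))%:E.
Proof.
have [_ X_law X_indep] := X_WIS.
rewrite sample_cylinder X_indep (perm_big (index_iota 0 n)) /=; last first.
  apply: uniq_perm; rewrite ?fset_uniq ?iota_uniq // => i.
  by rewrite !inE /index_iota subn0.
rewrite big_mkord -prodEFin; apply: eq_bigr => k _; rewrite -(X_law k); congr (P _).
apply/seteqP; split=> t /=.
  by move/(_ (ltn_ord k)) => ->; congr (g _); exact: val_inj.
by move=> -> lt_kn; congr (g _); exact: val_inj.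
Qed.

(** The event is a finite disjoint union of the cylinders of the [g] satisfying [Q], so
    probabilities on [T] become finite sums against the product law. *)
Lemma sample_event_prob n (Q : pred {ffun 'I_n -> V}) :
  P [set t | Q [ffun k : 'I_n => X k t]]%classic =
  (\sum_(g | Q g) \prod_k sampling_prob w (g k))%:E.
Proof.
have -> : [set t | Q [ffun k : 'I_n => X k t]]%classic =
    (\bigcup_(g in [set` Q]) [set t | [ffun k : 'I_n => X k t] = g])%classic.
  apply/seteqP; split=> t /=; last by move=> [g Qg /= ->].
  by exists [ffun k : 'I_n => X k t].
rewrite measure_fin_bigcup; last 3 first.
- exact: finite_finset.
- by move=> g h _ _ [t [/= <- <-]].
- by move=> g _; exact: measurable_sample_cylinder.
rewrite -sumEFin (@fsbigE _ _ _ _ _ (enum Q)) ?enum_uniq //; last 2 first.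
- by move=> g /=; rewrite mem_enum.
- by move=> g /= Qg; rewrite mem_enum => /negP[].
rewrite big_enum_cond; apply: eq_big => [g|g _]; last by rewrite -sample_law.
by rewrite mem_setE andbb.
Qed.

Lemma sample_codom n t : sample X n t = codom [ffun k : 'I_n => X k t].
Proof.
rewrite /sample -val_enum_ord -map_comp /codom /image_mem.
by apply: eq_map => k /=; rewrite ffunE.
Qed.

Lemma category_size_est_tail (A : {set V}) (eps : R) n :
  (forall v, 0 < w v) -> (0 < #|V|)%N -> 0 < eps -> (0 < n)%N ->
  (P [set t | (eps < `|category_size_est w A (sample X n t) - #|A|%:R|)%R]%classic <=
   ((\sum_v sampling_prob w v * centered_score w A v ^+ 2) *
     ((\sum_u w u) / eps) ^+ 2 / n%:R)%R%:E)%E.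
Proof.
move=> w_gt0 /card_gt0P[v0 _] eps_gt0 n_gt0.
pose Q (g : {ffun 'I_n -> V}) :=
  eps < `|category_size_est w A (codom g) - #|A|%:R|.
have -> : [set t | eps < `|category_size_est w A (sample X n t) - #|A|%:R|]%classic =
    [set t | Q [ffun k : 'I_n => X k t]]%classic.
  by apply/seteqP; split=> t /=; rewrite /Q -sample_codom.
have W_gt0 := total_weight_gt0 w_gt0 v0.
have n_gt0' : 0 < n%:R :> R by rewrite ltr0n.
(* An error above [eps] forces the score sum above [a], since the denominator is at least [n] over
   the total weight. As [a] is linear in [n], the Chebyshev bound n/a^2 decays like 1/n. *)
pose a := eps * (n%:R / \sum_u w u).
have a_gt0 : 0 < a by rewrite mulr_gt0 // divr_gt0.
rewrite sample_event_prob lee_fin.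
have p_ge0 := sampling_prob_ge0 w_gt0.
apply: (@le_trans _ _ (\sum_(g : {ffun 'I_n -> V} |
    a < `|\sum_k centered_score w A (g k)|) \prod_k sampling_prob w (g k))).
  rewrite [leLHS]big_mkcond [leRHS]big_mkcond; apply: ler_sum => g _.
  have prod_ge0 : 0 <= \prod_k sampling_prob w (g k) by apply: prodr_ge0.
  case: ifP => [Qg|_]; last by case: ifP.
  have size_g : size (codom g) = n by rewrite size_codom card_ord.
  have := large_error_large_score w_gt0 _ Qg eps_gt0.
  by rewrite size_g big_map big_enum => ->.
have p_sum1 := sampling_prob_sum1 w_gt0 v0.
have f_mean0 := centered_score_mean0 A w_gt0.
apply: le_trans (product_law_chebyshev p_sum1 n p_ge0 f_mean0 a_gt0) _.
rewrite le_eqVlt; apply/orP; left; apply/eqP; rewrite /a; field.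
by rewrite !gt_eqF.
Qed.

End Sampling.

Theorem mainTheorem5 (R : realType) (V : finType) (e : rel V)
    (e_sym : symmetric e) (C : {set {set V}}) (C_part : finset.partition C [set: V]%SET)
    (A : {set V}) (A_C : A \in C) (w : V -> R) (w_gt0 : forall v : V, 0 < w v)
    (d : measure_display) (T : measurableType d) (P : probability T R)
    (X : nat -> T -> V) (X_WIS : weighted_independence_sampling P w X) :
  cvg_in_probability P
    (fun (n : nat) (t : T) => category_size_est w A (sample X n t))
    #|A|%:R.
Proof.
(* A block of a partition is nonempty, so [A] supplies a node. *)
have V_gt0 : (0 < #|V|)%N.
  have /and3P[_ _ C0] := C_part.
  have /set0Pn[v _] : A != finset.set0 by apply: contraNneq C0 => <-.
  by apply/card_gt0P; exists v.
move=> eps eps_gt0.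
pose K := (\sum_v sampling_prob w v * centered_score w A v ^+ 2) *
  ((\sum_u w u) / eps) ^+ 2.
(* The tail bound is stated only for nonempty samples: at [n = 0] the estimator is a division by
   zero, with value 0 by convention. *)
have n_gt0 : (\forall n \near \oo, (0 < n)%N)%classic by exact: nbhs_infty_gt.
have inv_n0 : ((n%:R : R)^-1 @[n --> \oo] --> (0 : R))%classic.
  have nR_gt0 : (\forall n \near \oo, 0 < (n%:R : R))%classic.
    by apply: filterS n_gt0 => n; rewrite ltr0n.
  exact/(gtr0_cvgV0 nR_gt0)/cvgr_idn.
have bound0 : ((K / n%:R)%:E @[n --> \oo] --> 0%E)%classic.
  apply: cvg_EFin; first exact: nearW.
  by rewrite -(mulr0 K); exact: cvgMl_tmp.
apply: (squeeze_cvge _ (cvg_cst 0%E) bound0).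
by apply: filterS n_gt0 => n n_gt0; rewrite measure_ge0 category_size_est_tail.
Qed.
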